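(* Let $\mathbb K$ be a discrete field, let $(V,\phi)$ be a topological flow over $\mathbb K$, and let $k\in\mathbb N$. Then the following are equivalent: (a) the topological entropy satisfies $\mathrm{ent}^*(V,\phi)=k$; (b) there exist $k$ coindependent non-stationary cocyclic $\phi$-cotrajectories $C(\phi,U_1),\ldots,C(\phi,U_k)$ of $V$ such that $\mathrm{ent}^*(C,\phi\restriction_C)=0$, where $C=\bigcap_{i=1}^k C(\phi,U_i)$. Moreover, $\mathrm{ent}^*(V,\phi)=\infty$ if and only if there exists a countably infinite coindependent family of non-stationary cocyclic $\phi$-cotrajectories of $V$.
   Context: $\mathbb N$ contains $0$. A Hausdorff topological $\mathbb K$-space is linearly topologized if it has a neighbourhood basis at $0$ consisting of $\mathbb K$-subspaces; it is linearly compact if moreover any collection of closed linear varieties (cosets of closed subspaces) with the finite intersection property has non-empty intersection. A topological flow is a pair $(V,\phi)$ with $V$ a linearly compact $\mathbb K$-space and $\phi\colon V\to V$ a continuous linear endomorphism. Let $\mathcal B(V)$ be the set of linearly compact open $\mathbb K$-subspaces of $V$. For $U\in\mathcal B(V)$ and $n\geq 1$ put $C_n(\phi,U)=U\cap\phi^{-1}U\cap\cdots\cap\phi^{-n+1}U$ and $C(\phi,U)=\bigcap_{n\ge1}C_n(\phi,U)$ (the $\phi$-cotrajectory of $U$). The topological entropy is $\mathrm{ent}^*(V,\phi)=\sup_{U\in\mathcal B(V)}H^*(\phi,U)\in\mathbb N\cup\{\infty\}$, where $H^*(\phi,U)=\lim_{n\to\infty}\frac1n\dim_{\mathbb K}(U/C_n(\phi,U))$.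 The cotrajectory $C(\phi,U)$ is cocyclic if $\dim_{\mathbb K}(V/U)=1$, and non-stationary if $C(\phi,U)$ is not open in $V$ (equivalently, the descending chain $C_n(\phi,U)$ does not stabilize). A finite family $\{N_i\mid i\in I\}$ of proper subspaces of $V$ is coindependent if $N_i+\bigcap_{j\neq i}N_j=V$ for all $i\in I$; an arbitrary family of proper subspaces is coindependent if every finite subfamily is. An empty intersection of subspaces of $V$ is $V$ (relevant when $k=0$). *)

(* Defs.v *)
From HB Require Import structures.
From mathcomp Require Import all_boot all_order all_algebra.
From mathcomp Require Import all_classical all_reals.
From mathcomp Require Import topology ereal.

Set Implicit Arguments.
Unset Strict Implicit.
Unset Printing Implicit Defensive.

Import Order.TTheory GRing.Theory Num.Theory.

Local Open Scope classical_set_scope.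
Local Open Scope ring_scope.

(* The library's topologicalLmodType asks for a
   numDomainType of scalars topologised by its norm; here the scalars form an
   arbitrary field with the discrete topology.  The library file tvs is not
   imported because its joins of lmodType with topologies are fixed over a
   numDomainType, which HB cannot reconcile with the join below. *)
HB.mixin Record isDiscTopLmodule (K : fieldType) V
    & Topological V & GRing.Lmodule K V := {
  dtl_add_continuous : continuous (fun z : V * V => z.1 + z.2) ;
  dtl_scale_continuous :
    continuous (fun z : discrete_topology K * V => (z.1 : K) *: z.2)
}.

#[short(type="discTopLmodType")]
HB.structure Definition DiscTopLmodule (K : fieldType) :=
  {V of Topological V & GRing.Lmodule K V & isDiscTopLmodule K V}.

Section LinearlyCompact.
Variables (K : fieldType) (V : discTopLmodType K).
Implicit Types (W U L : set V).

Definition is_subspace W : Prop := submod_closed (fun x : V => x \in W).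

(* All topological notions for a subspace W of V refer to the topology induced
   by V, through the library's [subspace W].  That type has the carrier of V
   and isolates the points outside W, so for subsets of W it gives exactly the
   induced topology. *)
Definition linearly_topologized W : Prop :=
  [/\ is_subspace W, hausdorff_space (subspace W) &
      forall N, nbhs (0 : subspace W) N ->
        exists L, [/\ is_subspace L, L `<=` W,
                      nbhs (0 : subspace W) (L : set (subspace W)) &
                      L `<=` N]].

Definition closed_linear_variety W (A : set V) : Prop :=
  exists x L, [/\ W x, is_subspace L, L `<=` W,
                  closed (L : set (subspace W)) &
                  A = [set x + y | y in L]].

Definition linearly_compact W : Prop :=
  linearly_topologized W /\
  forall F : set (set V), F `<=` closed_linear_variety W ->
    finI F id -> \bigcap_(A in F) A !=set0.

Definition lc_open W : set (set V) :=
  [set U | [/\ U `<=` W, linearly_compact U & open (U : set (subspace W))]].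

(* The classes of e_0, ..., e_(n-1) form a basis of U / L. *)
Definition quot_basis U L n (e : 'I_n -> V) : Prop :=
  (forall i, U (e i)) /\
  (forall u, U u -> exists! c : {ffun 'I_n -> K}, L (u - \sum_i c i *: e i)).

Definition quot_dim_is U L (n : nat) : Prop :=
  exists e : 'I_n -> V, quot_basis U L e.

(* dim (U / L), equal to +oo when U / L has no finite basis. *)
Definition quot_dim (R : realType) U L : \bar R :=
  xget +oo%E [set d | exists2 n : nat, quot_dim_is U L n & d = n%:R%:E].

Definition sum_sub U L : set V := [set x + y | x in U & y in L].

Definition is_proper_subspace U : Prop := is_subspace U /\ U <> setT.

(* Meant for finite J; see coindependent for arbitrary families. *)
Definition coindependent_fin (I : Type) (J : set I) (N : I -> set V) : Prop :=
  forall i, J i -> is_proper_subspace (N i) /\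
    sum_sub (N i) (\bigcap_(j in J `\ i) N j) = setT.

Definition coindependent (I : Type) (N : I -> set V) : Prop :=
  forall J : set I, finite_set J -> coindependent_fin J N.

End LinearlyCompact.

Section Entropy.
Variables (K : fieldType) (V : discTopLmodType K) (phi : V -> V).
Implicit Types (W U : set V).

Definition partial_cotrajectory U (n : nat) : set V :=
  \bigcap_(i < n) (iter i phi @^-1` U).

Definition cotrajectory U : set V :=
  \bigcap_(n in [set n | (1 <= n)%N]) partial_cotrajectory U n.

(* The sequence (1/n) dim (U / C_n), n >= 1, reindexed from 0. *)
Definition entropy_at (R : realType) U : \bar R :=
  limn (fun n => ((n.+1%:R^-1)%:E *
                  quot_dim R U (partial_cotrajectory U n.+1))%E).

(* Entropy of the flow (W, phi restricted to W), for W a linearly compact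
   phi-invariant subspace; ent*(V, phi) is the case W = setT.  For U contained
   in W and n >= 1, computing C_n with phi or with its restriction to W gives
   the same set. *)
Definition topological_entropy (R : realType) W : \bar R :=
  ereal_sup [set entropy_at R U | U in lc_open W].

Definition nonstationary_cocyclic U : Prop :=
  [/\ lc_open setT U, quot_dim_is setT U 1 & ~ open (cotrajectory U)].

End Entropy.

(* Main.v *)
Require Import Defs.
From HB Require Import structures.
From mathcomp Require Import all_boot all_order all_algebra.
From mathcomp Require Import finmap all_classical all_reals topology ereal.
From mathcomp Require ereal_normedtype.

Set Implicit Arguments.
Unset Strict Implicit.
Unset Printing Implicit Defensive.

Import Order.TTheory GRing.Theory Num.Theory.

Local Open Scope classical_set_scope.
Local Open Scope ring_scope.

(* The continuous linear forms on V are a K[X]-module, X acting by composition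
   with phi.  A cocyclic cotrajectory is the common kernel of the orbit of one
   form f, it is non-stationary iff f is torsion-free, and such cotrajectories
   are coindependent iff their forms are K[X]-independent: one direction solves
   an infinite linear system by linear compactness.  For a closed invariant W,
   an open U in W is cut out by finitely many forms, and choosing a maximal
   independent subset of size r gives r n - O(1) <= dim (U / C_n) <= r n + O(1).
   Hence ent*(W) is the rank of the module of forms restricted to W.  Finally,
   a form vanishing on the intersection of the C(f_i) lies in the submodule
   generated by the f_i, so that this intersection has entropy 0 iff every form
   is torsion modulo the f_i. *)

(** * Linear algebra of finite families of linear forms *)

Section LinearForms.
Variables (K : fieldType) (V : discTopLmodType K).
Implicit Types (W U L : set V) (I : finType).

Lemma is_subspaceP W :
  is_subspace W <-> W 0 /\ forall a u v, W u -> W v -> W (a *: u + v).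
Proof.
split=> [[W0 Wl]|[W0 Wl]].
  split; first by move: W0; rewrite unfold_in inE.
  move=> a u v Wu Wv; have := Wl a u v.
  by rewrite !unfold_in !inE; apply.
by split=> [|a u v]; rewrite !unfold_in !inE //; exact: Wl.
Qed.

Lemma subspace_add W u v : is_subspace W -> W u -> W v -> W (u + v).
Proof. by case/is_subspaceP=> _ Wl Wu Wv; rewrite -[u]scale1r; exact: Wl. Qed.

Lemma subspace_scale W a u : is_subspace W -> W u -> W (a *: u).
Proof. by case/is_subspaceP=> W0 Wl Wu; rewrite -[_ *: _]addr0; exact: Wl. Qed.

Lemma subspace_sub W u v : is_subspace W -> W u -> W v -> W (u - v).
Proof.
move=> sW Wu Wv; apply: subspace_add => //.
by rewrite -scaleN1r; exact: subspace_scale.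
Qed.

Lemma subspace_sum W I (P : pred I) (e : I -> V) (c : I -> K) :
  is_subspace W -> (forall i, P i -> W (e i)) ->
  W (\sum_(i | P i) c i *: e i).
Proof.
move=> sW We; apply: (big_ind W); first by case/is_subspaceP: sW.
  by move=> x y; exact: subspace_add.
by move=> i Pi; apply: subspace_scale => //; exact: We.
Qed.

Lemma subspaceT : is_subspace [set: V].
Proof. by apply/is_subspaceP. Qed.

Lemma subspace_bigI (J : Type) (D : set J) (F : J -> set V) :
  (forall j, D j -> is_subspace (F j)) -> is_subspace (\bigcap_(j in D) F j).
Proof.
move=> sF; apply/is_subspaceP; split=> [j Dj|a u v Fu Fv j Dj].
  by case/is_subspaceP: (sF _ Dj).
by case/is_subspaceP: (sF _ Dj) => _; apply; [exact: Fu|exact: Fv].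
Qed.

Lemma subspaceI W U : is_subspace W -> is_subspace U -> is_subspace (W `&` U).
Proof.
move=> /is_subspaceP[W0 Wl] /is_subspaceP[U0 Ul].
apply/is_subspaceP; split=> // a u v [Wu Uu] [Wv Uv].
by split; [exact: Wl|exact: Ul].
Qed.

Definition kernel (J : Type) (h : J -> {scalar V}) : set V :=
  [set x | forall l, h l x = 0].

Lemma subspace_kernel (J : Type) (h : J -> {scalar V}) :
  is_subspace (kernel h).
Proof.
apply/is_subspaceP; split=> [l|a u v hu hv l]; first by rewrite linear0.
by rewrite linearP /= hu hv mulr0 addr0.
Qed.

Definition eval_mx N r (h : 'I_N -> {scalar V}) (e : 'I_r -> V) : 'M[K]_(r, N) :=
  \matrix_(i, l) h l (e i).

Lemma eval_mx_sum N r (h : 'I_N -> {scalar V}) (e : 'I_r -> V) (c : 'rV_r) l :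
  h l (\sum_i c 0 i *: e i) = (c *m eval_mx h e) 0 l.
Proof.
rewrite linear_sum mxE; apply: eq_bigr => i _.
by rewrite linearZ /= mxE.
Qed.

Lemma small_row_kernel m n (A : 'M[K]_(m, n)) :
  (n < m)%N -> exists2 c : 'rV_m, c != 0 & c *m A = 0.
Proof.
move=> ltnm; have kA0 : kermx A != 0.
  by rewrite -mxrank_eq0 mxrank_ker subn_eq0 -ltnNge (leq_ltn_trans (rank_leq_col A)).
by case/rowV0Pn: kA0 => c /sub_kermxP cA c0; exists c.
Qed.

(** Take [r] maximal, which is possible since a row-free matrix with [N] columns has at most [N]
    rows: a vector of [W] whose row escaped the span could be appended to [e]. *)
Lemma exists_eval_basis N (h : 'I_N -> {scalar V}) W :
  exists r (e : 'I_r -> V), [/\ forall i, W (e i), row_free (eval_mx h e) &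
    forall w, W w -> ((\row_l h l w) <= eval_mx h e)%MS].
Proof.
pose P r := `[< exists e : 'I_r -> V,
  (forall i, W (e i)) /\ row_free (eval_mx h e) >].
have P0 : exists r, P r.
  exists 0%N; apply/asboolP; exists (fun=> 0); split; first by case.
  by rewrite -row_leq_rank.
have Ple r : P r -> (r <= N)%N.
  by move=> /asboolP[e [_ /eqP <-]]; exact: rank_leq_col.
case: (ex_maxnP P0 Ple) => r /asboolP[e [We fe]] rmax.
exists r, e; split=> // w Ww; apply: contraT => we.
suff /rmax : P (r + 1)%N by rewrite addn1 ltnn.
pose e' (i : 'I_(r + 1)) :=
  match fintype.split i with inl j => e j | inr _ => w end.
apply/asboolP; exists e'.
split; first by move=> i; rewrite /e'; case: (fintype.split i).
have -> : eval_mx h e' = col_mx (eval_mx h e) (\row_l h l w).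
  apply/matrixP => i l; rewrite !mxE /e'.
  by case: (fintype.split i) => j; rewrite !mxE.
rewrite -row_leq_rank -addsmxE addn1.
have := fe; rewrite /row_free => /eqP {1}<-.
by rewrite rank_ltmx // /ltmx addsmxSl addsmx_sub submx_refl.
Qed.

Lemma reindex_enum I (R : nmodType) (F : I -> R) :
  \sum_l F l = \sum_(l < #|I|) F (enum_val l).
Proof.
rewrite (reindex (fun l : 'I_#|I| => enum_val l)) //.
exact: (onW_bij _ (@enum_val_bij I)).
Qed.

Lemma form_in_span W I (h : I -> {scalar V}) (g : {scalar V}) :
  is_subspace W -> (forall x, W x -> kernel h x -> g x = 0) ->
  exists c : I -> K, forall x, W x -> g x = \sum_l c l * h l x.
Proof.
move=> sW hg; pose k (l : 'I_#|I|) := h (enum_val l).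
case: (exists_eval_basis k W) => r [e [We fe spe]].
(* Modulo [kernel h] every vector of [W] is a combination of the [e i], so it suffices to match [g]
   there; row-freeness makes [pinvmx] a right inverse. *)
pose c : 'cV_#|I| := pinvmx (eval_mx k e) *m \col_i g (e i).
exists (fun l => c (enum_rank l) 0) => x Wx.
have /submxP[a ax] := spe _ Wx.
have gx : g (x - \sum_i a 0 i *: e i) = 0.
  apply: hg; first by apply: subspace_sub => //; exact: subspace_sum.
  move=> l; rewrite linearB /=.
  have := congr1 (fun A : 'rV_#|I| => A 0 (enum_rank l)) ax.
  by rewrite mxE -eval_mx_sum /k enum_rankK => ->; rewrite subrr.
move/eqP: gx; rewrite linearB /= subr_eq0 => /eqP ->.
rewrite linear_sum [RHS]reindex_enum.
transitivity ((a *m \col_i g (e i)) 0 0).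
  by rewrite mxE; apply: eq_bigr => i _; rewrite linearZ /= !mxE.
rewrite -[\col__ _]mul1mx -(mulmxVp fe) -(mulmxA _ _ (\col__ _)) -/c mulmxA -ax mxE.
by apply: eq_bigr => l _; rewrite enum_valK mulrC; congr (_ * _); rewrite !mxE.
Qed.

Definition forms_free W (J : finType) (h : J -> {scalar V}) : Prop :=
  forall c : J -> K, (forall x, W x -> \sum_l c l * h l x = 0) ->
    forall l, c l = 0.

(** A column of the cokernel of the evaluation matrix is a linear relation among the forms on [W];
    freeness kills it, so the matrix has full column rank. *)
Lemma forms_free_onto W I (h : I -> {scalar V}) :
  is_subspace W -> forms_free W h ->
  forall t : I -> K, exists2 x, W x & forall l, h l x = t l.
Proof.
move=> sW hW t; pose k (l : 'I_#|I|) := h (enum_val l).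
case: (exists_eval_basis k W) => r [e [We fe spe]].
have full : row_full (eval_mx k e).
  rewrite -cokermx_eq0; apply/eqP/matrixP => l j; rewrite [RHS]mxE.
  rewrite -[l]enum_valK.
  apply: (hW (fun l => cokermx (eval_mx k e) (enum_rank l) j)) => x Wx.
  have /submxP[a ax] := spe _ Wx.
  transitivity (((\row_l k l x) *m cokermx (eval_mx k e)) 0 j).
    rewrite reindex_enum mxE; apply: eq_bigr => i _.
    by rewrite enum_valK mulrC [in RHS]mxE.
  by rewrite ax -mulmxA mulmx_coker mulmx0 mxE.
pose c := (\row_l t (enum_val l)) *m pinvmx (eval_mx k e).
exists (\sum_i c 0 i *: e i); first exact: subspace_sum.
move=> l; rewrite -[l]enum_rankK -[h _]/(k _) eval_mx_sum -mulmxA mulVpmx //.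
by rewrite mulmx1 mxE.
Qed.

(* [quot_dim_ge W L s] expresses s <= dim (W / (W `&` L)). *)
Definition quot_dim_ge W L s : Prop :=
  exists e : 'I_s -> V, (forall i, W (e i)) /\
    forall c : 'I_s -> K, L (\sum_i c i *: e i) -> forall i, c i = 0.

(** With more vectors than forms, some nontrivial combination would be killed by all forms and fall
    into [L]. *)
Lemma quot_dim_ge_le_forms W L s I (h : I -> {scalar V}) :
  is_subspace W -> W `&` kernel h `<=` L -> quot_dim_ge W L s -> (s <= #|I|)%N.
Proof.
move=> sW hL [e [We eL]]; rewrite leqNgt; apply/negP => lts.
pose k (l : 'I_#|I|) := h (enum_val l).
have [c c0 cA] := small_row_kernel (eval_mx k e) lts.
case/eqP: c0; apply/rowP => i; rewrite mxE; apply: (eL (fun i => c 0 i)).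
apply: hL; split; first exact: subspace_sum.
by move=> l; rewrite -[l]enum_rankK -[h _]/(k _) eval_mx_sum cA mxE.
Qed.

Lemma forms_free_quot_dim_ge W I (h : I -> {scalar V}) :
  is_subspace W -> forms_free W h -> quot_dim_ge W (kernel h) #|I|.
Proof.
move=> sW hW.
have dual (l : 'I_#|I|) : exists x, W x /\ forall j, h j x = (j == enum_val l)%:R.
  by case: (forms_free_onto sW hW (fun j => (j == enum_val l)%:R)) => x ? ?; exists x.
have [e eP] := choice dual; exists e; split=> [i|c he i]; first by case: (eP i).
rewrite -(he (enum_val i)) linear_sum (bigD1 i) //= linearZ /=.
rewrite (proj2 (eP i)) eqxx mulr1 big1 ?addr0 // => j ji.
by rewrite linearZ /= (proj2 (eP j)) (inj_eq enum_val_inj) eq_sym (negbTE ji) mulr0.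
Qed.

(** A basis of the relations among the rows of values of [g] on [e] gives combinations of [e] inside
    [kernel g]; at most [m] dimensions are lost. *)
Lemma quot_dim_ge_kernel W L s m (g : 'I_m -> {scalar V}) :
  is_subspace W -> quot_dim_ge W L s ->
  exists2 s', (s <= s' + m)%N & quot_dim_ge (W `&` kernel g) L s'.
Proof.
move=> sW [e [We eL]]; pose A := eval_mx g e.
exists (\rank (kermx A)).
  by rewrite mxrank_ker -leq_subLR subKn ?rank_leq_row // rank_leq_col.
pose B := row_base (kermx A).
have BA : B *m A = 0 by apply/sub_kermxP; rewrite eq_row_base.
exists (fun t => \sum_i B t i *: e i); split=> [t|c Lc t].
  split; first exact: subspace_sum.
  move=> l; transitivity (g l (\sum_i (row t B) 0 i *: e i)).
    by apply: (congr1 (g l)); apply: eq_bigr => i _; rewrite [row t B 0 i]mxE.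
  by rewrite eval_mx_sum -row_mul BA row0 mxE.
pose d := \row_t c t.
suff /eqP : d *m B = 0.
  rewrite mulmx_free_eq0 ?row_base_free // => /eqP d0.
  by have := congr1 (fun b : 'rV_(\rank (kermx A)) => b 0 t) d0; rewrite !mxE.
apply/rowP => i; rewrite [RHS]mxE; apply: (eL (fun i => (d *m B) 0 i)).
move: Lc; congr L; under eq_bigr do rewrite scaler_sumr.
rewrite exchange_big; apply: eq_bigr => j _; rewrite mxE scaler_suml.
by apply: eq_bigr => u _; rewrite scalerA [d 0 u]mxE.
Qed.

Lemma quot_basis_dim_ge U L n (e : 'I_n -> V) :
  is_subspace U -> is_subspace L -> quot_basis U L e -> quot_dim_ge U L n.
Proof.
move=> sU sL [Ue basis_e]; exists e; split=> // c Lc i.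
have [U0 _] := iffLR (is_subspaceP _) sU.
have [c0 [_ c0P]] := basis_e 0 U0.
have c00 : c0 = 0.
  apply: c0P; rewrite big1 ?subr0; first by case/is_subspaceP: sL.
  by move=> j _; rewrite ffunE scale0r.
have /(congr1 (fun f : {ffun 'I_n -> K} => f i)) : c0 = [ffun i => - c i].
  apply: c0P; rewrite sub0r -sumrN; move: Lc; congr L; apply: eq_bigr => j _.
  by rewrite ffunE scaleNr opprK.
by rewrite c00 !ffunE => /eqP; rewrite eq_sym oppr_eq0 => /eqP.
Qed.

Lemma quot_dim_ge_le_basis U L s n (e : 'I_n -> V) :
  is_subspace L -> quot_basis U L e -> quot_dim_ge U L s -> (s <= n)%N.
Proof.
move=> sL [Ue basis_e] [u [Uu uL]]; rewrite leqNgt; apply/negP => ltns.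
have coord t : exists c : {ffun 'I_n -> K}, L (u t - \sum_i c i *: e i).
  by case: (basis_e _ (Uu t)) => c [? _]; exists c.
have [C CP] := choice coord.
have [a a0 aC] := small_row_kernel (\matrix_(t, i) C t i) ltns.
case/eqP: a0; apply/rowP => t; rewrite mxE; apply: (uL (fun i => a 0 i)).
have := @subspace_sum L _ predT (fun t => u t - \sum_i C t i *: e i) (a 0) sL
  (fun t _ => CP t).
congr L; under eq_bigr do rewrite scalerBr; rewrite sumrB.
rewrite -[RHS]subr0; congr (_ - _).
under eq_bigr do rewrite scaler_sumr; rewrite exchange_big big1 //= => i _.
have := congr1 (fun A : 'rV_n => A 0 i) aC; rewrite !mxE => aCi.
rewrite -[RHS](scale0r (e i)) -aCi scaler_suml; apply: eq_bigr => j _.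
by rewrite scalerA mxE.
Qed.

Lemma quot_dim_kernel W I (h : I -> {scalar V}) :
  is_subspace W -> exists d, quot_dim_is W (W `&` kernel h) d.
Proof.
move=> sW; pose k (l : 'I_#|I|) := h (enum_val l).
case: (exists_eval_basis k W) => r [e [We fe spe]].
exists r, e; split=> // w Ww; have /submxP[a ax] := spe _ Ww.
have hE (c : {ffun 'I_r -> K}) l : h l (\sum_i c i *: e i) =
    ((\row_i c i) *m eval_mx k e) 0 (enum_rank l).
  rewrite -eval_mx_sum /k enum_rankK; apply: (congr1 (h l)).
  by apply: eq_bigr => i _; rewrite mxE.
have hw l : h l w = (a *m eval_mx k e) 0 (enum_rank l).
  by rewrite -ax mxE /k enum_rankK.
exists [ffun i => a 0 i]; split.
  split; first by apply: subspace_sub => //; exact: subspace_sum.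
  move=> l; rewrite linearB /= hE hw; apply/eqP; rewrite subr_eq0; apply/eqP.
  by congr ((_ *m _) 0 _); apply/rowP => i; rewrite mxE ffunE.
move=> c [_ hc]; apply/ffunP => i; rewrite ffunE.
suff -> : a = \row_i c i by rewrite mxE.
apply: (row_free_inj fe); apply/rowP => l; rewrite -[l]enum_valK -hw -hE.
by apply/eqP; rewrite -subr_eq0 -linearB; apply/eqP; exact: hc.
Qed.

Lemma quot_basis_forms L n (e : 'I_n -> V) :
  is_subspace L -> quot_basis setT L e ->
  exists g : 'I_n -> {scalar V}, L = kernel g.
Proof.
move=> sL [_ basis_e].
have coord x : exists c : {ffun 'I_n -> K}, L (x - \sum_i c i *: e i).
  by case: (basis_e x I) => c [? _]; exists c.
have [C CP] := choice coord.
have CU x (c : {ffun 'I_n -> K}) : L (x - \sum_i c i *: e i) -> C x = c.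
  move=> Lc; case: (basis_e x I) => c0 [_ c0P].
  by rewrite -(c0P _ (CP x)); exact: c0P.
have lin i : linear_for *%R (fun x => C x i).
  move=> a u v; have -> : C (a *: u + v) = [ffun i => a * C u i + C v i].
    apply: CU.
    have := subspace_add sL (subspace_scale a sL (CP u)) (CP v).
    congr L; rewrite scalerBr addrACA -opprD; congr (_ - _).
    rewrite scaler_sumr -big_split; apply: eq_bigr => j _ /=.
    by rewrite ffunE scalerDl scalerA.
  by rewrite ffunE.
pose g i : {scalar V} := HB.pack (fun x => C x i)
  (GRing.isLinear.Build K V K *%R (fun x => C x i) (lin i)).
exists g; apply/seteqP; split=> x /=.
  move=> Lx i; rewrite /g /= (CU x [ffun=> 0]) ?ffunE //.
  by rewrite big1 ?subr0 // => j _; rewrite ffunE scale0r.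
move=> gx; have := CP x; rewrite big1 ?subr0 // => j _.
by rewrite -[C x j]/(g j x) gx scale0r.
Qed.

End LinearForms.

Arguments subspaceT {K V}.

(** Supports greedy choices: each term may depend on the whole list of earlier ones. *)
Lemma course_of_values (T : Type) (G : seq T -> T) :
  exists e : nat -> T, forall n, e n = G (mkseq e n).
Proof.
pose s := fix s n := if n is m.+1 then rcons (s m) (G (s m)) else [::].
exists (fun n => G (s n)) => n; congr G.
by elim: n => [//|n IHn]; rewrite mkseqS -IHn.
Qed.

(** * Finite combinations of a sequence of vectors *)

Section Combinations.
Variables (K : fieldType) (V : lmodType K).
Implicit Types (e : nat -> V) (c d : {poly K}).

(** A polynomial encodes a finitely supported sequence of scalars; when [e] is the orbit of [x]
    under [phi], the same sum is p(phi) x. *)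
Definition comb e c : V := \sum_(i < size c) c`_i *: e i.

Lemma comb_widen e c n : (size c <= n)%N -> comb e c = \sum_(i < n) c`_i *: e i.
Proof.
move=> lecn; rewrite /comb (big_ord_widen n (fun i => c`_i *: e i)) //.
rewrite big_mkcond; apply: eq_bigr => i _; case: ltnP => // le_i.
by rewrite nth_default ?scale0r.
Qed.

Lemma comb_is_linear e : linear (comb e).
Proof.
move=> a c d; pose n := maxn (size (a *: c + d)) (maxn (size c) (size d)).
rewrite !(@comb_widen e _ n) ?leq_max ?leqnn ?orbT //.
rewrite scaler_sumr -big_split; apply: eq_bigr => i _ /=.
by rewrite coefD coefZ scalerDl scalerA.
Qed.

HB.instance Definition _ e :=
  GRing.isLinear.Build K {poly K} V *:%R (comb e) (@comb_is_linear e).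

Lemma comb_Xn e n : comb e 'X^n = e n.
Proof.
rewrite /comb size_polyXn big_ord_recr big1 /= => [|i _].
  by rewrite add0r coefXn eqxx scale1r.
by rewrite coefXn ltn_eqF // scale0r.
Qed.

End Combinations.

(** * Open subspaces, continuous forms and linear compactness *)

Section Topology.
Variables (K : fieldType) (V : discTopLmodType K).
Implicit Types (W U L N : set V).

Lemma nbhs_translate (a x : V) N : nbhs (x + a) N -> nbhs x [set y | N (y + a)].
Proof.
move=> /(@dtl_add_continuous K V (x, a))[[A B] [/= xA aB] AB].
apply: filterS xA => y Ay; apply: (AB (y, a)); split=> //=.
exact: nbhs_singleton.
Qed.

Lemma open_subspace_nbhs L : is_subspace L -> nbhs 0 L -> open L.
Proof.
move=> sL L0; rewrite openE => x Lx.
have := @nbhs_translate (- x) x L; rewrite subrr => /(_ L0).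
apply: filterS => y /= Lyx; rewrite -(subrK x y); exact: subspace_add.
Qed.

Lemma open_subspace_sup U L :
  is_subspace U -> is_subspace L -> open U -> U `<=` L -> open L.
Proof.
move=> sU sL oU UL; apply: open_subspace_nbhs => //; apply: filterS UL _.
by apply: open_nbhs_nbhs; split=> //; case/is_subspaceP: sU.
Qed.

Lemma open_subspace_closed L : is_subspace L -> open L -> closed L.
Proof.
move=> sL oL; rewrite -[L]setCK; apply: open_closedC; rewrite openE => x nLx.
have L0 : nbhs 0 L by apply: open_nbhs_nbhs; split=> //; case/is_subspaceP: sL.
have := @nbhs_translate (- x) x L; rewrite subrr => /(_ L0).
apply: filterS => y /= Lyx Ly; apply: nLx.
by rewrite -[x](subKr y); exact: subspace_sub.
Qed.

(** With discrete scalars, a linear form is continuous exactly when its kernel is open. *)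
Record cform := CForm {
  cform_form :> {scalar V};
  cform_open : open [set x | cform_form x = 0] }.

Lemma open_kernel (I : finType) (h : I -> cform) : open (kernel h).
Proof.
apply: open_subspace_nbhs; first exact: subspace_kernel.
apply: filter_forall => i; apply: open_nbhs_nbhs; split; first exact: cform_open.
exact: linear0.
Qed.

Lemma closed_kernel (J : Type) (h : J -> cform) : closed (kernel h).
Proof.
have -> : kernel h = \bigcap_(i in setT) [set x | h i x = 0].
  by apply/seteqP; split=> x hx i => [_|]; exact: hx.
apply: closed_bigI => i _; apply: open_subspace_closed; last exact: cform_open.
have := subspace_kernel (fun _ : unit => h i : {scalar V}).
congr is_subspace; apply/seteqP; split=> x /=; first by move/(_ tt).
by move=> hx.
Qed.

Hypothesis lcV : linearly_compact [set: V].

Lemma linear_nbhs N : nbhs (0 : V) N ->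
  exists L, [/\ is_subspace L, open L & L `<=` N].
Proof.
case: lcV => -[_ _ basis] _ N0.
have {N0}N0 : nbhs (0 : subspace [set: V]) N by rewrite nbhs_subspaceT.
have [L [sL _ L0 LN]] := basis N N0; exists L; split=> //; apply: open_subspace_nbhs => //.
by rewrite -nbhs_subspaceT.
Qed.

Lemma open_in_subspace W U : is_subspace W -> is_subspace U -> U `<=` W ->
  open (U : set (subspace W)) ->
  exists O, [/\ is_subspace O, open O & U = W `&` O].
Proof.
move=> sW sU UW /open_subspaceP[O' oO' O'W].
have O'U : O' `&` W = U by rewrite O'W; exact: setIidl.
have U0 : U 0 by case/is_subspaceP: sU.
have O'0 : nbhs 0 O'.
  by apply: open_nbhs_nbhs; split=> //; move: U0; rewrite -O'U => -[].
case: (linear_nbhs O'0) => L [sL oL LO].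
(* [O] is L + U. If x + y lies in [W] with x in [L] and y in [U], then x lies in [W] as well, hence
   in both [O'] and [W], that is in [U]. *)
pose O := [set z | exists x y, [/\ L x, U y & z = x + y]].
have sO : is_subspace O.
  apply/is_subspaceP; split.
    by exists 0, 0; rewrite addr0; split=> //; case/is_subspaceP: sL.
  move=> a _ _ [x [y [Lx Uy ->]]] [x' [y' [Lx' Uy' ->]]].
  exists (a *: x + x'), (a *: y + y'); split.
  - by case/is_subspaceP: sL => _; apply.
  - by case/is_subspaceP: sU => _; apply.
  - by rewrite scalerDr addrACA.
exists O; split=> //.
  apply: (open_subspace_sup sL) => // x Lx.
  by exists x, 0; rewrite addr0.
apply/seteqP; split=> z.
  move=> Uz; split; first exact: UW.
  by exists 0, z; rewrite add0r; split=> //; case/is_subspaceP: sL.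
case=> Wz [x [y [Lx Uy zE]]]; rewrite zE; apply: subspace_add => //.
rewrite -O'U; split; first exact: LO.
by rewrite -[x](addrK y) -zE; apply: subspace_sub => //; exact: UW.
Qed.

Lemma closed_linearly_compact W :
  is_subspace W -> closed W -> linearly_compact W.
Proof.
move=> sW cW; have W0 : W 0 by case/is_subspaceP: sW.
case: lcV => -[_ hV _] lc; split.
  split=> //.
    apply: subspace_hausdorff => p q pq; apply: hV => A B.
    by rewrite !nbhs_subspaceT; exact: pq.
  have nbhsE : nbhs (0 : subspace W) = within W (nbhs (0 : V)).
    by rewrite nbhs_subspace_in.
  move=> N; rewrite nbhsE => /linear_nbhs[L [sL oL LN]].
  have L0 : L 0 by case/is_subspaceP: sL.
  exists (L `&` W); split.
  - exact: subspaceI.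
  - by move=> x [].
  - have : within W (nbhs 0) (L `&` W).
      apply: filterS (open_nbhs_nbhs (conj oL L0)) => x Lx Wx; by split.
    by rewrite -nbhsE; apply.
  - by move=> x [Lx Wx]; exact: LN.
move=> F FW; apply: lc => A /FW[x [L [Wx sL LW cL ->]]].
exists x, L; split=> //; apply: closed_subspaceW.
case/closed_subspaceP: cL => C cC CL.
have -> : L = C `&` W by rewrite CL; apply/esym/setIidl.
exact: closedI.
Qed.

(** Along a decreasing chain, finitely many members meet in the one of largest index, so the finite
    intersection property is just non-emptiness. *)
Lemma lc_chain (B : nat -> set V) :
  (forall n, B n !=set0) -> (forall n, B n.+1 `<=` B n) ->
  (forall n x, B n x -> exists L,
     [/\ is_subspace L, closed L & B n = [set x + y | y in L]]) ->
  exists x, forall n, B n x.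
Proof.
move=> B0 BS Bvar; case: lcV => _ lc.
have Bdecr m n : (m <= n)%N -> B n `<=` B m.
  elim: n => [|n IHn]; first by rewrite leqn0 => /eqP ->.
  by rewrite leq_eqVlt => /predU1P[->//|/IHn mn x /BS /mn].
case: (lc (range B)).
- move=> _ [n _ <-]; case: (B0 n) => x Bx; case: (Bvar _ _ Bx) => L [sL cL BE].
  by exists x, L; split=> //; exact: closed_subspaceW.
- move=> D DB.
  have ix A : exists n, A \in D -> A = B n.
    have [/DB|_] := boolP (A \in D); last by exists 0%N.
    by rewrite inE => -[n _ <-]; exists n.
  have [f fP] := choice ix.
  case: (B0 (\max_(A <- D) f A)%N) => x Bx; exists x => A /= AD.
  by rewrite (fP _ AD); apply: Bdecr Bx; exact: leq_bigmax_seq.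
- by move=> x Bx; exists x => n; apply: (Bx (B n)); exists n.
Qed.

(* If no finite family spanned V modulo U, some e would have each e_n outside
   U + <e_0, ..., e_(n-1)>; the nested varieties
   e_0 + ... + e_(n-1) + <e_j | j >= n> + U would then have empty
   intersection. *)
Lemma open_subspace_quot_basis U : is_subspace U -> open U ->
  exists n (e : 'I_n -> V), quot_basis setT U e.
Proof.
move=> sU oU; have U0 : U 0 by case/is_subspaceP: sU.
pose spanned (s : seq V) v :=
  exists2 c : {poly K}, (size c <= size s)%N & U (v - comb (nth 0 s) c).
(* Greedy choice: e_n is a vector not spanned modulo [U] by its predecessors, or the default 0 once
   none is left. *)
have [e eE] := course_of_values (fun s => xget 0 [set v | ~ spanned s v]).
have spannedE n v : spanned (mkseq e n) v <->
    exists2 c : {poly K}, (size c <= n)%N & U (v - comb e c).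
  have combE (c : {poly K}) : (size c <= n)%N ->
      comb (nth 0 (mkseq e n)) c = comb e c.
    by move=> cn; apply: eq_bigr => i _; rewrite nth_mkseq // (leq_trans _ cn).
  by rewrite /spanned size_mkseq; split=> -[c cn Uc]; exists c => //;
     move: Uc; rewrite combE.
have free n (c : {poly K}) :
    (forall m, (m < n)%N -> ~ spanned (mkseq e m) (e m)) ->
    (size c <= n)%N -> U (comb e c) -> c = 0.
  move=> en cn Uc; apply/eqP/negPn/negP => c0.
  have sc : (0 < size c)%N by rewrite lt0n size_poly_eq0.
  apply: (en (size c).-1); first by rewrite prednK.
  apply/spannedE.
  (* Divided by its leading coefficient, the relation expresses its last vector through the earlier
     ones modulo [U]. *)
  exists ('X^((size c).-1) - (lead_coef c)^-1 *: c).
    apply/leq_sizeP => j; rewrite leq_eqVlt => /predU1P[<-|ltj].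
      rewrite coefB coefXn eqxx coefZ -lead_coefE mulVf ?subrr //.
      by rewrite lead_coef_eq0.
    rewrite coefB coefXn gtn_eqF // coefZ nth_default ?mulr0 ?subr0 //.
    by move: ltj; rewrite prednK.
  rewrite linearB linearZ /= comb_Xn opprB addrCA subrr addr0.
  exact: subspace_scale.
have [[n nsp]|inf] := pselect (exists n, forall v, spanned (mkseq e n) v).
  have ex : exists n, `[< forall v, spanned (mkseq e n) v >].
    by exists n; apply/asboolP.
  case: (ex_minnP ex) => {nsp}n /asboolP nsp nmin.
  have en m : (m < n)%N -> ~ spanned (mkseq e m) (e m).
    move=> ltmn; rewrite [e m]eE; case: xgetP => [x _ //|all_sp].
    have : (n <= m)%N.
      by apply: nmin; apply/asboolP => v; apply: contrapT => /all_sp.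
    by rewrite leqNgt ltmn.
  exists n, (fun i => e i); split=> // u _.
  have [c cn Uc] := iffLR (spannedE _ _) (nsp u).
  exists [ffun i : 'I_n => c`_i]; split.
    by rewrite (comb_widen _ cn) in Uc; under eq_bigr do rewrite ffunE.
  move=> d Ud; pose q := \poly_(i < n) (if insub i is Some j then d j else 0).
  have qE (i : 'I_n) : q`_i = d i by rewrite coef_poly ltn_ord valK.
  have qn : (size q <= n)%N by exact: size_poly.
  apply/ffunP => i; rewrite ffunE -qE; suff -> : c = q by [].
  apply/eqP; rewrite -subr_eq0; apply/eqP; apply: (free n) => //.
    by rewrite (leq_trans (size_polyD _ _)) // geq_max cn size_polyN.
  rewrite linearB /= (comb_widen _ qn); under [X in _ - X]eq_bigr do rewrite qE.
  by have := subspace_sub sU Ud Uc; rewrite opprB addrC addrA subrK.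
have en m : ~ spanned (mkseq e m) (e m).
  rewrite [e m]eE; case: xgetP => [x _ //|all_sp]; case: inf; exists m => v.
  by apply: contrapT => /all_sp.
pose B n x := exists c : {poly K},
  (forall j, (j < n)%N -> c`_j = 1) /\ U (x - comb e c).
pose L n x := exists c : {poly K},
  (forall j, (j < n)%N -> c`_j = 0) /\ U (x - comb e c).
have sL n : is_subspace (L n).
  apply/is_subspaceP; split.
    by exists 0; rewrite linear0 subr0; split=> // j _; rewrite coef0.
  move=> a u v [c [c0 Uc]] [d [d0 Ud]]; exists (a *: c + d); split=> [j jn|].
    by rewrite coefD coefZ c0 // d0 // mulr0 addr0.
  rewrite linearP /= opprD addrACA -scalerBr.
  by case/is_subspaceP: sU => _; apply.
have cL n : closed (L n).
  apply: open_subspace_closed => //; apply: (open_subspace_sup sU) => // x Ux.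
  by exists 0; rewrite linear0 subr0; split=> // j _; rewrite coef0.
case: (@lc_chain B) => [n|n|n x Bx|x xB].
- exists (comb e (\poly_(i < n) 1)), (\poly_(i < n) 1); rewrite subrr.
  by split=> // j jn; rewrite coef_poly jn.
- by move=> x [c [c1 Uc]]; exists c; split=> // j jn; apply: c1; exact: leqW.
- exists (L n); split=> //; case: Bx => c [c1 Uc].
  apply/seteqP; split=> [y [d [d1 Ud]]|_ [y [d [d0 Ud]] <-]].
    exists (y - x); last by rewrite addrC subrK.
    exists (d - c); split=> [j jn|]; first by rewrite coefB c1 // d1 // subrr.
    have := subspace_sub sU Ud Uc; rewrite opprB linearB /= opprB addrACA.
    by rewrite [- comb e d + _]addrC addrACA.
  exists (c + d); split=> [j jn|]; first by rewrite coefD c1 // d0 // addr0.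
  by rewrite linearD /= opprD addrACA; exact: subspace_add.
(* A common point is congruent modulo [U] to the combination given by [c], and also to one given by
   [d] whose coefficient at [size c] is 1, where that of [c] is 0; [free] forbids this. *)
have [c [_ Uc]] := xB 0%N; have [d [d1 Ud]] := xB (size c).+1.
suff /(congr1 (fun p : {poly K} => p`_(size c))) : c - d = 0.
  by rewrite coefB d1 // nth_default // coef0 sub0r => /eqP; rewrite oppr_eq0 oner_eq0.
apply: (free (size (c - d))) => //.
by have := subspace_sub sU Ud Uc; rewrite opprB linearB /= addrC addrA subrK.
Qed.

Lemma open_subspace_forms U : is_subspace U -> open U ->
  exists m (g : 'I_m -> cform), U = kernel g.
Proof.
move=> sU oU; have [m [e eU]] := open_subspace_quot_basis sU oU.
have [g Ug] := quot_basis_forms sU eU.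
have go i : open [set x | g i x = 0].
  apply: (open_subspace_sup sU) => //; last by rewrite Ug => x; apply.
  have := subspace_kernel (fun _ : unit => g i).
  congr is_subspace; apply/seteqP; split=> x /=; first by move/(_ tt).
  by move=> hx.
by exists m, (fun i => CForm (go i)).
Qed.

(** The solutions of stage [n] form a coset of a closed subspace, and these cosets shrink with [n],
    so [lc_chain] applies. *)
Lemma cform_system_solvable (J : Type) (h : J -> cform) (t : J -> K)
    (D : nat -> set J) :
  (forall n, D n `<=` D n.+1) ->
  (forall n, exists x, forall l, D n l -> h l x = t l) ->
  exists x, forall n l, D n l -> h l x = t l.
Proof.
move=> DS sol; apply: (@lc_chain (fun n x => forall l, D n l -> h l x = t l)) => //.
  by move=> n x Bx l Dl; apply: Bx; exact: DS.
move=> n x Bx; exists (kernel (fun l : {l | D n l} => h (projT1 l))); split.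
- exact: subspace_kernel.
- exact: closed_kernel.
- apply/seteqP; split=> [y By|_ [y hy <-] l Dl].
    exists (y - x); last by rewrite addrC subrK.
    by case=> l Dl; rewrite linearB /= Bx // By // subrr.
  by rewrite linearD /= (hy (exist _ l Dl)) addr0 Bx.
Qed.

End Topology.

(** * The action of K[X] on V through phi *)

Section PolynomialAction.
Variables (K : fieldType) (V : lmodType K) (phi : {linear V -> V}).
Implicit Types (p q : {poly K}) (x : V).

Lemma iter_is_linear n : linear (iter n phi).
Proof. by elim: n => [//|n IHn] a u v; rewrite !iterS IHn linearP. Qed.

HB.instance Definition _ n :=
  GRing.isLinear.Build K V V *:%R (iter n phi) (@iter_is_linear n).

Definition pact p x : V := comb (fun i => iter i phi x) p.

Lemma pact_is_linear p : linear (pact p).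
Proof.
move=> a u v; rewrite /pact /comb scaler_sumr -big_split.
by apply: eq_bigr => i _ /=; rewrite linearP scalerDr !scalerA mulrC.
Qed.

HB.instance Definition _ p :=
  GRing.isLinear.Build K V V *:%R (pact p) (@pact_is_linear p).

Lemma pactXn n x : pact 'X^n x = iter n phi x.
Proof. exact: comb_Xn. Qed.

Lemma pact1 x : pact 1 x = x.
Proof. by rewrite -(expr0 'X) pactXn. Qed.

Lemma pactXM q x : pact ('X * q) x = pact q (phi x) /\
                   pact ('X * q) x = phi (pact q x).
Proof.
have -> : pact ('X * q) x = \sum_(i < size q) q`_i *: iter i.+1 phi x.
  rewrite /pact (@comb_widen _ _ _ _ (size q).+1).
    rewrite big_ord_recl coefXM scale0r add0r.
    by apply: eq_bigr => i _; rewrite coefXM.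
  by apply: leq_trans (size_polyMleq _ _) _; rewrite size_polyX.
split; first by apply: eq_bigr => i _; rewrite iterSr.
by rewrite [RHS]linear_sum; apply: eq_bigr => i _; rewrite linearZ.
Qed.

Lemma pactM p q x : pact (p * q) x = pact p (pact q x).
Proof.
elim/poly_ind: p q x => [|p c IHp] q x; first by rewrite mul0r /pact !linear0.
rewrite -alg_polyC mulrDl -mulrA -scalerAl mul1r /pact !linearD !linearZ /=.
rewrite -!/(pact _ _) IHp pact1 (proj2 (pactXM _ _)); congr (_ + _).
by rewrite mulrC (proj1 (pactXM _ _)).
Qed.

Lemma pact_stable (W : set V) p x :
  W 0 -> (forall a u v, W u -> W v -> W (a *: u + v)) ->
  (forall y, W y -> W (phi y)) -> W x -> W (pact p x).
Proof.
move=> W0 Wl Wphi Wx; apply: (big_ind W) => // [y z Wy Wz|i _].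
  by rewrite -[y]scale1r; exact: Wl.
rewrite -[_ *: _]addr0; apply: Wl => //; elim: (i : nat) => // n Wn.
by rewrite iterS; exact: Wphi.
Qed.

Lemma form_pact0 (f : {scalar V}) p n x : (size p <= n)%N ->
  (forall j, (j < n)%N -> f (iter j phi x) = 0) -> f (pact p x) = 0.
Proof.
move=> pn fx; rewrite linear_sum big1 // => i _; rewrite linearZ /= fx ?mulr0 //.
exact: leq_trans pn.
Qed.

End PolynomialAction.

(** * Independence and torsion of forms over K[X] *)

Section Rank.
Variables (K : fieldType) (V : discTopLmodType K) (phi : {linear V -> V}).
Hypothesis phi_cont : continuous phi.
Implicit Types (W : set V) (f g : nat -> cform V) (p q : nat -> {poly K}).

Lemma iter_continuous n : continuous (iter n phi).
Proof.
elim: n => [|n IHn] x /=; first exact: cvg_id.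
by apply: continuous_comp; [exact: IHn|exact: phi_cont].
Qed.

Lemma cform_iter_open (f : cform V) n :
  open [set x | (f \o iter n phi : {scalar V}) x = 0].
Proof.
apply: (@open_comp _ _ (iter n phi) [set x | f x = 0]).
  by move=> x _; exact: iter_continuous.
exact: cform_open.
Qed.

Definition cform_iter (f : cform V) n : cform V := CForm (cform_iter_open f n).

Lemma cform_pact_open (f : cform V) (p : {poly K}) :
  open [set x | (f \o pact phi p : {scalar V}) x = 0].
Proof.
pose h (i : 'I_(size p)) := cform_iter f i.
apply: (@open_subspace_sup _ _ (kernel h)).
- exact: subspace_kernel.
- have := subspace_kernel (fun _ : unit => f \o pact phi p : {scalar V}).
  congr is_subspace; apply/seteqP; split=> x /=; first by move/(_ tt).
  by move=> hx.
- exact: open_kernel.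
- move=> x hx; apply: (@form_pact0 _ _ phi f p (size p)) => // j jp.
  exact: (hx (Ordinal jp)).
Qed.

Definition cform_pact (f : cform V) (p : {poly K}) : cform V :=
  CForm (cform_pact_open f p).

(** Fills up finite families of forms to sequences indexed by [nat]. *)
Definition cform0 : cform V.
Proof.
apply: (@CForm _ _ (\0 : {scalar V})).
by have := @openT V; congr open; apply/seteqP; split.
Defined.

(* Independence over K[X] of the restrictions to W of the first k forms. *)
Definition indep W k f : Prop := forall p,
  (forall x, W x -> \sum_(i < k) f i (pact phi (p i) x) = 0) ->
  forall i, (i < k)%N -> p i = 0.

(** Torsion in the quotient of the K[X]-module of forms on [W] by the submodule that the first [k]
    members of [f] generate. *)
Definition torsion W k f (g : {scalar V}) : Prop :=
  exists2 p : {poly K}, p != 0 & exists q : nat -> {poly K}, forall x, W x ->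
    g (pact phi p x) = \sum_(i < k) f i (pact phi (q i) x).

Lemma subspace_pact (W : set V) (r : {poly K}) x : is_subspace W ->
  (forall y, W y -> W (phi y)) -> W x -> W (pact phi r x).
Proof. by case/is_subspaceP=> W0 Wl ? ?; exact: pact_stable. Qed.

Lemma indep_prefix W m n f : (m <= n)%N -> indep W n f -> indep W m f.
Proof.
move=> lemn fn p hp i im.
have := fn (fun i => if (i < m)%N then p i else 0) _ i (leq_trans im lemn).
rewrite im; apply.
move=> x Wx; apply: eq_trans (hp x Wx).
rewrite (big_ord_widen n (fun i => f i (pact phi (p i) x))) // [RHS]big_mkcond.
by apply: eq_bigr => j _; case: ifP => // _; rewrite /pact !linear0.
Qed.

Lemma eq_indep W k f g : (forall i, (i < k)%N -> f i = g i) ->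
  indep W k f -> indep W k g.
Proof.
move=> fg fW p hp; apply: fW => x /hp hx; apply: eq_trans hx.
by apply: eq_bigr => i _; rewrite fg.
Qed.

Lemma indep_ext W k f :
  indep W k f -> ~ torsion W k f (f k) -> indep W k.+1 f.
Proof.
move=> fW ntor p hp.
have pk0 : p k = 0.
  apply/eqP/negPn/negP => pk; apply: ntor; exists (p k) => //.
  exists (fun i => - p i) => x Wx.
  have /eqP := hp x Wx; rewrite big_ord_recr /= addrC addr_eq0 => /eqP ->.
  by rewrite -sumrN; apply: eq_bigr => i _; rewrite /pact !linearN.
move=> i; rewrite ltnS leq_eqVlt => /predU1P[->//|]; apply: fW => x Wx.
by have := hp x Wx; rewrite big_ord_recr /= pk0 {2}/pact !linear0 addr0.
Qed.

Lemma torsion_ext W k f g (h : {scalar V}) :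
  (forall i, (i < k)%N -> f i = g i) -> torsion W k f h -> torsion W k.+1 g h.
Proof.
move=> fg [p p0 [q hq]]; exists p => //.
exists (fun i => if (i < k)%N then q i else 0) => x Wx.
rewrite hq // big_ord_recr /= ltnn {3}/pact !linear0 addr0.
by apply: eq_bigr => i _; rewrite ltn_ord fg.
Qed.

(** Greedy: [g m] is kept only if it is not torsion modulo the forms kept so far. As the [f i] are
    taken among the [g l], they vanish on the common kernel of the latter. *)
Lemma maximal_indep W g m : exists r f, [/\ indep W r f,
  forall l, (l < m)%N -> torsion W r f (g l) &
  forall i, (i < r)%N -> exists2 l, (l < m)%N & f i = g l].
Proof.
elim: m => [|m [r [f [fW ft fg]]]]; first by exists 0%N, g; split.
have [tor|ntor] := pselect (torsion W r f (g m)).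
  exists r, f; split=> // [l|i /fg[l lm fl]]; last by exists l => //; exact: leqW.
  by rewrite ltnS leq_eqVlt => /predU1P[->//|]; exact: ft.
pose f' i := if (i < r)%N then f i else g m.
have ff' i : (i < r)%N -> f i = f' i by rewrite /f' => ->.
have f'r : f' r = g m by rewrite /f' ltnn.
exists r.+1, f'; split.
- apply: indep_ext; first exact: eq_indep fW.
  rewrite f'r => -[p p0 [q hq]]; apply: ntor; exists p => //; exists q => x Wx.
  by rewrite hq //; apply: eq_bigr => i _; rewrite ff'.
- move=> l; rewrite ltnS leq_eqVlt => /predU1P[->|lm]; last first.
    by apply: torsion_ext ff' _; exact: ft.
  exists 1; first exact: oner_neq0.
  exists (fun i => (i == r)%:R) => x Wx.
  rewrite big_ord_recr /= f'r eqxx big1 ?add0r // => i _.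
  by rewrite ltn_eqF // /pact !linear0.
- move=> i; rewrite ltnS leq_eqVlt => /predU1P[->|/[dup] ir /fg[l lm fl]].
    by exists m.
  by exists l; [exact: leqW|rewrite -ff'].
Qed.

(* Dividing X^j by the torsion polynomial p of g, the forms g o phi^j lie in the
   span of the g o phi^i with i < deg p and of the f_i o phi^l with l < j + c. *)
Lemma torsion_bound W r f m g : is_subspace W ->
  (forall y, W y -> W (phi y)) ->
  (forall l, (l < m)%N -> torsion W r f (g l)) ->
  exists c, forall n x, W x ->
    (forall l j, (l < m)%N -> (j < c)%N -> g l (iter j phi x) = 0) ->
    (forall i j, (i < r)%N -> (j < n + c)%N -> f i (iter j phi x) = 0) ->
    forall l j, (l < m)%N -> (j < n)%N -> g l (iter j phi x) = 0.
Proof.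
move=> sW Wphi tor.
have bnd l : exists c, (l < m)%N -> forall n x, W x ->
    (forall j, (j < c)%N -> g l (iter j phi x) = 0) ->
    (forall i j, (i < r)%N -> (j < n + c)%N -> f i (iter j phi x) = 0) ->
    forall j, (j < n)%N -> g l (iter j phi x) = 0.
  case: (ltnP l m) => [lm|_]; last by exists 0%N.
  have [p p0 [q hq]] := tor l lm.
  (* The bound covers the size of [p], for the remainder of X^j, and that of every [q i], for the
     products of [q i] with the quotient. *)
  exists (maxn (size p) (\max_(i < r) size (q i))) => _ n x Wx gx fx j jn.
  rewrite -pactXn (divp_eq 'X^j p) /pact linearD /= -!/(pact _ _ _) linearD /=.
  rewrite [X in _ + X](@form_pact0 _ _ phi (g l) _ (size p)); first last.
  - by move=> i ip; apply: gx; rewrite leq_max ip.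
  - by apply: ltnW; rewrite ltn_modp.
  rewrite addr0 mulrC pactM hq; last exact: subspace_pact.
  rewrite big1 // => i _; rewrite -pactM.
  set s := 'X^j %/ p.
  have sz : (size (q i * s)%R <= n + maxn (size p) (\max_(i < r) size (q i)))%N.
    apply: leq_trans (size_polyMleq _ _) _.
    have sj : (size s <= j.+1)%N by rewrite -(size_polyXn K j) leq_divp.
    have qi : (size (q i) <= maxn (size p) (\max_(i < r) size (q i)))%N.
      by rewrite leq_max (leq_bigmax i) orbT.
    rewrite -subn1 leq_subLR addnA addnC leq_add //.
    by apply: leq_trans sj _; rewrite add1n; exact: leqW.
  by apply: form_pact0 sz _ => k kn; apply: fx.
have [c cP] := choice bnd.
exists (\max_(l < m) c l) => n x Wx gx fx l j lm jn.
have cl : (c l <= \max_(l < m) c l)%N by exact: (leq_bigmax (Ordinal lm)).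
apply: (cP l lm n x Wx _ _ j jn) => [k kc|i k ir kn].
  by apply: gx => //; exact: leq_trans cl.
by apply: fx => //; apply: leq_trans kn _; rewrite leq_add2l.
Qed.

(** Passes from K-combinations of the orbit forms f_i o phi^j to K[X]-combinations of the f_i: the
    scalar at (i, j) becomes the coefficient of X^j in [p i]. *)
Lemma poly_of_coefs k n (c : 'I_k * 'I_n -> K) :
  exists2 p : nat -> {poly K}, (forall (i : 'I_k) (j : 'I_n), (p i)`_j = c (i, j)) &
    forall f x, \sum_(i < k) f i (pact phi (p i) x) =
                \sum_l c l * f l.1 (iter l.2 phi x).
Proof.
pose cc (i j : nat) : K :=
  if (insub i, insub j) is (Some i', Some j') then c (i', j') else 0.
have ccE (i' : 'I_k) (j' : 'I_n) : cc i' j' = c (i', j') by rewrite /cc !valK.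
exists (fun i => \poly_(j < n) cc i j) => [i j|f x].
  by rewrite coef_poly ltn_ord ccE.
transitivity (\sum_(i < k) \sum_(j < n) c (i, j) * f i (iter j phi x)); last first.
  by rewrite pair_bigA; apply: eq_bigr => -[a b] _.
apply: eq_bigr => i _; rewrite /pact (comb_widen _ (size_poly _ _)) linear_sum.
by apply: eq_bigr => j _; rewrite linearZ /= coef_poly ltn_ord ccE.
Qed.

Lemma indep_forms_free W k f n : indep W k f ->
  forms_free W (fun ij : 'I_k * 'I_n => cform_iter (f ij.1) ij.2).
Proof.
move=> fW c hc [i j]; have [p pc pE] := poly_of_coefs c.
rewrite -pc (fW p) ?coef0 // => x Wx; rewrite pE; exact: hc.
Qed.

End Rank.

(** The numbers [D n] stay within bounded distance of r (n + 1), so the quotients differ from [r] by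
    at most (m + c) / (n + 1). *)
Lemma scaled_limn (R : realType) (d : nat -> \bar R) (D : nat -> nat) (r m c : nat) :
  (forall n, d n = (D n)%:R%:E) ->
  (forall n, (r * n.+1 <= D n + m)%N) -> (forall n, (D n <= r * n.+1 + c)%N) ->
  limn (fun n => ((n.+1%:R^-1)%:E * d n)%E) = r%:R%:E :> \bar R.
Proof.
move=> dE Dge Dle; apply: cvg_lim; first exact: ereal_normedtype.ereal_hausdorff.
move=> A /= [e /= e0 eA].
pose C := (m + c)%:R : R.
exists (Num.truncn (C / e)).+1 => // n /= Nn.
rewrite dE -EFinM; apply: eA => /=.
have n0 : 0 < n.+1%:R :> R by rewrite ltr0n.
have -> : r%:R - n.+1%:R^-1 * (D n)%:R = n.+1%:R^-1 * ((r * n.+1)%:R - (D n)%:R) :> R.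
  by rewrite mulrBr natrM mulrCA mulVf ?mulr1 // gt_eqF.
rewrite normrM gtr0_norm ?invr_gt0 // mulrC ltr_pdivrMr //.
apply: (@le_lt_trans _ _ C).
  rewrite ler_distl lerBlDr -!natrD !ler_nat; apply/andP; split.
    by apply: leq_trans (Dle n) _; rewrite leq_add2l leq_addl.
  by apply: leq_trans (Dge n) _; rewrite leq_add2l leq_addr.
rewrite mulrC -ltr_pdivrMr //; apply: lt_le_trans (truncnS_gt _) _.
by rewrite ler_nat; exact: leqW.
Qed.

(** * Entropy as the rank of the module of forms *)

Section EntropyRank.
Variables (R : realType) (K : fieldType) (V : discTopLmodType K).
Variable phi : {linear V -> V}.
Hypotheses (lcV : linearly_compact [set: V]) (phi_cont : continuous phi).
Implicit Types (U W L : set V) (f g : nat -> cform V).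
Local Notation cform_iter := (cform_iter phi_cont).
Local Notation indep := (indep phi).
Local Notation torsion := (torsion phi).

(** This is the [n]-th partial cotrajectory of the common kernel of the first [m] forms. *)
Definition orbit_kernel m g n : set V :=
  [set x | forall l j, (l < m)%N -> (j < n)%N -> g l (iter j phi x) = 0].

Lemma orbit_kernelE m g n :
  orbit_kernel m g n = kernel (fun l : 'I_m * 'I_n => cform_iter (g l.1) l.2).
Proof.
apply/seteqP; split=> [x gx [l j]|x gx l j lm jn]; first exact: gx.
exact: (gx (Ordinal lm, Ordinal jn)).
Qed.

Lemma subspace_orbit_kernel m g n : is_subspace (orbit_kernel m g n).
Proof. by rewrite orbit_kernelE; exact: subspace_kernel. Qed.

Lemma quot_dim_geS U L L' s : is_subspace U -> U `&` L' `<=` L ->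
  quot_dim_ge U L s -> quot_dim_ge U L' s.
Proof.
move=> sU LL [e [Ue eL]]; exists e; split=> // c Lc; apply: eL; apply: LL.
by split=> //; exact: subspace_sum.
Qed.

Lemma indep_quot_dim_ge W r f n : is_subspace W -> indep W r f ->
  quot_dim_ge W (orbit_kernel r f n) (r * n).
Proof.
move=> sW /(indep_forms_free (phi_cont := phi_cont) (n := n)).
move/(forms_free_quot_dim_ge sW).
by rewrite card_prod !card_ord orbit_kernelE.
Qed.

(** The family [h] lists the forms whose vanishing [torsion_bound] asks for: m c initial ones for
    [g] and r (n + c) for [f]. The constant [c] does not depend on [n] or [U]. *)
Lemma torsion_quot_dim_le W r f m g : is_subspace W ->
  (forall y, W y -> W (phi y)) ->
  (forall l, (l < m)%N -> torsion W r f (g l)) ->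
  exists c, forall U n s, is_subspace U -> U `<=` W ->
    quot_dim_ge U (orbit_kernel m g n) s -> (s <= m * c + r * (n + c))%N.
Proof.
move=> sW Wphi /(torsion_bound sW Wphi)[c cP]; exists c => U n s sU UW sep.
pose h (l : 'I_m * 'I_c + 'I_r * 'I_(n + c)) : cform V :=
  match l with
  | inl l => cform_iter (g l.1) l.2
  | inr l => cform_iter (f l.1) l.2
  end.
have := quot_dim_ge_le_forms (h := h) sU _ sep.
rewrite card_sum !card_prod !card_ord; apply => x [Ux hx].
apply: cP; first exact: UW.
  by move=> l j lm jc; exact: (hx (inl (Ordinal lm, Ordinal jc))).
by move=> i j ir jc; exact: (hx (inr (Ordinal ir, Ordinal jc))).
Qed.

(** Compares growth rates in [n]: the independent forms give at least k n dimensions, torsion allows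
    at most r n + O(1). *)
Lemma indep_torsion_le W r f k g : is_subspace W ->
  (forall y, W y -> W (phi y)) ->
  (forall l, (l < k)%N -> torsion W r f (g l)) -> indep W k g -> (k <= r)%N.
Proof.
move=> sW Wphi tor gW; have [c cP] := torsion_quot_dim_le sW Wphi tor.
(* [n] is chosen so that (k - r) n exceeds k c + r c. *)
rewrite leqNgt; apply/negP => rk; pose n := (k * c + r * c).+1.
have := cP W n (k * n)%N sW (fun _ => id) (indep_quot_dim_ge n sW gW).
rewrite mulnDr addnCA -leq_subLR -mulnBl leqNgt => /negP; apply.
by rewrite (leq_trans (ltnSn _)) // leq_pmull // subn_gt0.
Qed.

(** Invariance keeps the orbit of a point of [W] inside [W]; the index [n.+1] guarantees the term of
    index 0, which places the point itself in [W]. *)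
Lemma partial_cotrajectory_kernel W m g n : (forall y, W y -> W (phi y)) ->
  partial_cotrajectory phi (W `&` kernel (fun l : 'I_m => g l : {scalar V})) n.+1 =
  W `&` orbit_kernel m g n.+1.
Proof.
move=> Wphi; apply/seteqP; split=> x.
  move=> Cx; split; first by case: (Cx 0%N).
  by move=> l j lm jn; case: (Cx j jn) => _ /(_ (Ordinal lm)).
case=> Wx gx j /= jn; split; last by move=> l; exact: gx.
by elim: j {jn} => // j IHj; rewrite iterS; exact: Wphi.
Qed.

(** [xget] may select any basis length, so the selected one is carried along as [d'] instead of
    being compared with [d]. *)
Lemma quot_dimP U L d : quot_dim_is U L d ->
  exists2 d', quot_dim_is U L d' & quot_dim R U L = d'%:R%:E.
Proof.
move=> Ud; rewrite /quot_dim; case: xgetP => [_ -> [d' ? ->]|/(_ d%:R%:E)].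
  by exists d'.
by case; exists d.
Qed.

(** The dimension of U / C_n lies between r n - m and r n + O(1): the upper bound is
    [torsion_quot_dim_le], and the lower one loses at most [m] dimensions on passing from [W] to
    [U]. *)
Lemma entropy_at_forms W m g : is_subspace W ->
  (forall y, W y -> W (phi y)) ->
  exists r f, [/\ indep W r f, forall l, (l < m)%N -> torsion W r f (g l) &
    entropy_at phi R (W `&` kernel (fun l : 'I_m => g l : {scalar V})) = r%:R%:E].
Proof.
move=> sW Wphi; case: (maximal_indep phi W g m) => r [f [fW tor fg]].
exists r, f; split=> //.
have [c cP] := torsion_quot_dim_le sW Wphi tor.
set U := W `&` _.
have sU : is_subspace U by apply: subspaceI => //; exact: subspace_kernel.
have dim n : exists d, quot_dim R U (partial_cotrajectory phi U n.+1) = d%:R%:E /\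
    quot_dim_is U (U `&` orbit_kernel m g n.+1) d.
  have [d /quot_dimP[d' Ud' dE]] := quot_dim_kernel
    (fun l : 'I_m * 'I_n.+1 => cform_iter (g l.1) l.2) sU.
  exists d'; rewrite /U partial_cotrajectory_kernel //; rewrite -orbit_kernelE in Ud' dE.
  split=> //; rewrite -dE; congr quot_dim; rewrite /U -setIA; congr (_ `&` _).
  apply/esym/setIidr => x gx l; exact: (gx l 0%N).
have [D DP] := choice dim.
apply: (@scaled_limn R _ D r m (m * c + r * c)) => n; case: (DP n) => // _ [e basis_e].
  have [s rs sep] := quot_dim_ge_kernel (fun l : 'I_m => g l : {scalar V}) sW
    (indep_quot_dim_ge n.+1 sW fW).
  apply: leq_trans rs _; rewrite leq_add2r.
  apply: quot_dim_ge_le_basis basis_e _.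
    by apply: subspaceI => //; exact: subspace_orbit_kernel.
  apply: quot_dim_geS sep => // x [_ [_ gx]] i j ir jn.
  by have [l lm ->] := fg i ir; exact: gx.
rewrite addnCA -mulnDr; apply: (cP U) => // [x []//|].
have sL : is_subspace (U `&` orbit_kernel m g n.+1).
  by apply: subspaceI => //; exact: subspace_orbit_kernel.
by apply: quot_dim_geS (quot_basis_dim_ge sU sL basis_e) => // x [].
Qed.

(** As [V] is linearly compact, these conditions make [W] with the restriction of [phi] a
    topological flow. *)
Definition closed_invariant W : Prop :=
  [/\ is_subspace W, closed W & forall y, W y -> W (phi y)].

Lemma lc_open_forms W U : is_subspace W -> lc_open W U ->
  exists m g, U = W `&` kernel (fun l : 'I_m => g l : {scalar V}).
Proof.
move=> sW [UW [[sU _ _] _] oU].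
have [O [sO oO UE]] := open_in_subspace lcV sW sU UW oU.
have [m [g OE]] := open_subspace_forms lcV sO oO.
exists m, (fun l => if insub l is Some l' then g l' else cform0 V).
by rewrite UE OE; congr (_ `&` _); apply/seteqP; split=> x gx l;
  have := gx l; rewrite valK.
Qed.

Lemma lc_open_kernel W m g : is_subspace W -> closed W ->
  lc_open W (W `&` kernel (fun l : 'I_m => g l : {scalar V})).
Proof.
move=> sW cW; split; first by move=> x [].
  apply: closed_linearly_compact => //.
    by apply: subspaceI => //; exact: subspace_kernel.
  by apply: closedI => //; exact: closed_kernel.
apply/open_subspaceP; exists (kernel (fun l : 'I_m => g l : {scalar V})).
  exact: open_kernel.
by rewrite setIAC setIid setIC.
Qed.

(** Tested on the open subspace of [W] cut out by the [k] forms themselves: its entropy is the size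
    [r] of an independent family modulo which they are torsion, so k <= r. *)
Lemma entropy_ge W k f : closed_invariant W -> indep W k f ->
  (k%:R%:E <= topological_entropy phi R W)%E.
Proof.
move=> [sW cW Wphi] fW; have [r [h [hW tor hE]]] := entropy_at_forms k f sW Wphi.
apply: (@le_trans _ _ r%:R%:E).
  by rewrite lee_fin ler_nat; exact: (indep_torsion_le sW Wphi tor fW).
rewrite -hE; apply: ereal_sup_ubound.
by eexists; first exact: (lc_open_kernel k f sW cW).
Qed.

Lemma entropy_le W k : closed_invariant W ->
  (forall r f, indep W r f -> (r <= k)%N) ->
  (topological_entropy phi R W <= k%:R%:E)%E.
Proof.
move=> [sW cW Wphi] indepW; apply: ge_ereal_sup.
move=> _ [U /(lc_open_forms sW)[m [g ->]] <-].
have [r [h [hW _ ->]]] := entropy_at_forms m g sW Wphi.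
by rewrite lee_fin ler_nat; exact: indepW hW.
Qed.

End EntropyRank.

(** * Cotrajectories of forms, non-stationarity and coindependence *)

Section Cotrajectories.
Variables (K : fieldType) (V : discTopLmodType K) (phi : {linear V -> V}).
Hypotheses (lcV : linearly_compact [set: V]) (phi_cont : continuous phi).
Implicit Types (U W : set V) (f g : nat -> cform V).
Local Notation cform_iter := (cform_iter phi_cont).
Local Notation indep := (indep phi).
Local Notation torsion := (torsion phi).

Definition cotraj (f : cform V) : set V := [set x | forall j, f (iter j phi x) = 0].

Lemma cotrajectoryE (f : cform V) : cotrajectory phi [set x | f x = 0] = cotraj f.
Proof.
apply/seteqP; split=> [x fx j|x fx n _ j _]; last exact: fx.
exact: (fx j.+1 isT j (ltnSn j)).
Qed.

Lemma cotraj_kernel (f : cform V) : cotraj f = kernel (cform_iter f).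
Proof. by []. Qed.

Lemma subspace_cotraj (f : cform V) : is_subspace (cotraj f).
Proof. by rewrite cotraj_kernel; exact: subspace_kernel. Qed.

Lemma cotraj_pact (f : cform V) (p : {poly K}) x :
  cotraj f x -> f (pact phi p x) = 0.
Proof. by move=> fx; apply: form_pact0 (leqnn _) _ => j _; exact: fx. Qed.

Lemma bigcap_cotraj_invariant (J : Type) (D : set J) (f : J -> cform V) :
  closed_invariant phi (\bigcap_(i in D) cotraj (f i)).
Proof.
split; first by apply: subspace_bigI => i _; exact: subspace_cotraj.
  by apply: closed_bigI => i _; rewrite cotraj_kernel; exact: closed_kernel.
by move=> x fx i Di j; rewrite -iterSr; exact: fx.
Qed.

Lemma setT_invariant : closed_invariant phi [set: V].
Proof. by split=> //; exact: subspaceT. Qed.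

Lemma indep1_neq0 (f : cform V) : indep [set: V] 1 (fun=> f) -> exists x, f x = 1.
Proof.
move=> fV; suff [x fx] : exists x, f x != 0.
  by exists ((f x)^-1 *: x); rewrite linearZ /= mulVf.
apply: contrapT => f0; have := oner_neq0 {poly K}; rewrite (fV (fun=> 1) _ 0%N) ?eqxx //.
move=> x _; rewrite big_ord1 pact1; apply/eqP; apply: contrapT => /negP fx.
by apply: f0; exists x.
Qed.

(** An open subspace of codimension 1 is the kernel of a continuous form f. If f is torsion,
    finitely many f o phi^i already cut out the cotrajectory, which is then open; if not, C_n has
    codimension at least n for every n, whereas an open subspace has finite codimension. *)
Lemma nonstationary_cocyclicP U : nonstationary_cocyclic phi U <->
  exists2 f : cform V, U = [set x | f x = 0] & indep [set: V] 1 (fun=> f).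
Proof.
split=> [[lcU [e basis_e] nC]|[f -> fV]].
  have [_ [[sU _ _] _] oU'] := lcU.
  have oU : open U.
    have [O [_ oO ->]] :=
      open_in_subspace lcV subspaceT sU (@subsetT _ U) oU'.
    by rewrite setTI.
  have [g UE] := quot_basis_forms sU basis_e.
  have {}UE : U = [set x | g ord0 x = 0].
    by rewrite UE; apply/seteqP; split=> x /= gx // l; rewrite ord1.
  rewrite UE in oU; pose f := CForm oU; exists f => // p hp i.
  rewrite ltnS leqn0 => /eqP -> {i}; apply/eqP/negPn/negP => p0; apply: nC.
  have tor l : (l < 1)%N -> torsion setT 0 (fun=> f) f.
    move=> _; exists (p 0%N) => //; exists (fun=> 0) => x _.
    by have := hp x I; rewrite big_ord1 big_ord0.
  have [c cP] := torsion_bound (g := fun=> f) subspaceT (fun _ _ => I) tor.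
  rewrite UE -[X in cotrajectory _ X]/[set x | f x = 0] cotrajectoryE.
  have -> : cotraj f = kernel (fun i : 'I_c => cform_iter f i).
    apply/seteqP; split=> x fx j; first exact: fx.
    apply: (cP j.+1 x I _ _ 0%N j) => // l k _ kc; exact: (fx (Ordinal kc)).
  exact: open_kernel.
have [x0 fx0] := indep1_neq0 fV.
have kerE : [set x | f x = 0] =
    setT `&` kernel (fun l : 'I_1 => (fun=> f) (l : nat) : {scalar V}).
  by rewrite setTI; apply/seteqP; split=> x /= fx; [move=> l|exact: (fx ord0)].
split.
- by rewrite kerE; exact: (lc_open_kernel lcV 1 (fun=> f) subspaceT closedT).
- exists (fun=> x0); split=> // u _; exists [ffun=> f u]; split.
    by rewrite /= big_ord1 ffunE linearB linearZ /= fx0 mulr1 subrr.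
  move=> c /= /eqP; rewrite big_ord1 linearB linearZ /= fx0 mulr1 subr_eq0 => /eqP fu.
  by apply/ffunP => i; rewrite ffunE ord1.
- rewrite cotrajectoryE => oC.
  have [n [e basis_e]] := open_subspace_quot_basis lcV (subspace_cotraj f) oC.
  have := indep_quot_dim_ge phi_cont n.+1 subspaceT fV; rewrite mul1n.
  move/(quot_dim_geS (L' := cotraj f) subspaceT) => sep.
  have : (n.+1 <= n)%N.
    apply: quot_dim_ge_le_basis (subspace_cotraj f) basis_e _; apply: sep.
    by move=> x [_ fx] i j _ _; exact: fx.
  by rewrite ltnn.
Qed.

(** If no finite part of the orbits forced [h] to vanish, linear compactness would produce a point
    of all the cotrajectories where [h] is 1. So finitely many orbit forms suffice, and
    [form_in_span] gives the coefficients. *)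
Lemma form_in_orbit_span k f (h : cform V) :
  (forall x, (forall i, (i < k)%N -> cotraj (f i) x) -> h x = 0) ->
  exists q : nat -> {poly K}, forall x, h x = \sum_(i < k) f i (pact phi (q i) x).
Proof.
move=> hf.
have [n nP] : exists n, forall x, orbit_kernel phi k f n x -> h x = 0.
  apply: contrapT => noP.
  (* The index [None] carries the equation h x = 1, and [Some (i, j)] the vanishing of f_i o phi^j
     at x. *)
  pose hh (l : option (nat * nat)) :=
    if l is Some (i, j) then cform_iter (f i) j else h.
  pose t (l : option (nat * nat)) : K := if l is Some _ then 0 else 1.
  pose D n (l : option (nat * nat)) : Prop :=
    if l is Some (i, j) then (i < k)%N && (j < n)%N else True.
  case: (@cform_system_solvable _ _ lcV _ hh t D).
  - by move=> n [[i j] /= /andP[-> /leqW ->]|].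
  - move=> n; apply: contrapT => nox; apply: noP; exists n => x fx.
    apply/eqP; apply: contrapT => /negP hx; apply: nox.
    exists ((h x)^-1 *: x) => -[[i j] /= /andP[ik jn]|_] /=.
      by rewrite !linearZ /= fx // mulr0.
    by rewrite linearZ /= mulVf.
  - move=> x hx; have /eqP := oner_neq0 K; apply.
    rewrite -[1]/(t None) -(hx 0%N None I); apply: hf => i ik j.
    by apply: (hx j.+1 (Some (i, j))); rewrite /D ik ltnSn.
have [x _ hk|c cP] := @form_in_span _ _ setT _
  (fun l : 'I_k * 'I_n => cform_iter (f l.1) l.2) h subspaceT.
  by apply: nP; rewrite (orbit_kernelE phi_cont).
have [q _ qE] := poly_of_coefs phi c.
by exists q => x; rewrite qE cP.
Qed.

(** The system makes all f_i o phi^b vanish at x while the other f_j o phi^b agree at x and v.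
    Independence solves each finite stage, linear compactness the whole. *)
Lemma indep_split n f i v : indep [set: V] n f -> (i < n)%N ->
  exists2 x, cotraj (f i) x &
    forall j, (j < n)%N -> j != i -> cotraj (f j) (v - x).
Proof.
move=> fV ltin.
pose t (l : nat * nat) : K := if l.1 == i then 0 else f l.1 (iter l.2 phi v).
case: (@cform_system_solvable _ _ lcV _ (fun l => cform_iter (f l.1) l.2) t
  (fun m => [set l | (l.1 < n)%N /\ (l.2 < m)%N])).
- by move=> m [a b] /= [-> /leqW ->].
- move=> m.
  have [x _ hx] := forms_free_onto subspaceT
    (indep_forms_free (phi_cont := phi_cont) (n := m) fV)
    (fun l => t (l.1 : nat, l.2 : nat)).
  by exists x => -[a b] /= [an bm]; exact: (hx (Ordinal an, Ordinal bm)).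
- move=> x hx; exists x => [b|j jn ji b].
    by rewrite -[LHS]/(cform_iter (f i) b x) (hx b.+1 (i, b)) // /t eqxx.
  rewrite !linearB /= -[f j (iter b phi x)]/(cform_iter (f j) b x).
  by rewrite (hx b.+1 (j, b)) // /t /= (negbTE ji) subrr.
Qed.

(** Evaluated at v - x, a relation retains only its i-th term, and that term vanishes at x; so it
    vanishes at every v, and torsion-freeness of f_i gives p_i = 0. *)
Lemma split_indep n f :
  (forall i, (i < n)%N -> indep [set: V] 1 (fun=> f i)) ->
  (forall i v, (i < n)%N -> exists2 x, cotraj (f i) x &
    forall j, (j < n)%N -> j != i -> cotraj (f j) (v - x)) ->
  indep [set: V] n f.
Proof.
move=> f1 fs p hp i ltin.
apply: (f1 i ltin (fun=> p i) _ 0%N) => // v _; rewrite big_ord1.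
have [x fx fy] := fs i v ltin.
rewrite -[v](subrK x) linearD /= linearD /= (cotraj_pact _ fx) addr0.
have := hp (v - x) I; rewrite (bigD1 (Ordinal ltin)) //= big1 ?addr0 // => j ji.
by rewrite cotraj_pact //; apply: fy.
Qed.

(** The injection [s] allows for both index types ['I_k] and [nat]. *)
Lemma cotraj_coindependent n f (I : Type) (J : set I) (s : I -> nat) :
  injective s -> (forall i, J i -> (s i < n)%N) -> indep [set: V] n f ->
  coindependent_fin J (fun i => cotraj (f (s i))).
Proof.
move=> s_inj Jn fV i Ji; split; last first.
  apply/seteqP; split=> // v _.
  have [x fx fy] := indep_split v fV (Jn _ Ji).
  exists x => //; exists (v - x); last by rewrite addrC subrK.
  move=> j [Jj /= ji]; apply: fy; first exact: Jn.
  by apply/eqP => /s_inj.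
split; first exact: subspace_cotraj.
(* Properness: a cotrajectory equal to V forces f_(s i) = 0, which is a relation with coefficient
   1. *)
move=> fT; have /eqP := oner_neq0 {poly K}; apply.
pose p j : {poly K} := (j == s i)%:R.
have <- : p (s i) = 1 by rewrite /p eqxx.
apply: fV (Jn _ Ji) => x _; rewrite big1 // => j _; rewrite /p.
case: eqP => [->|_]; last by rewrite /pact !linear0.
by rewrite pact1; have : cotraj (f (s i)) x by [rewrite fT|]; move/(_ 0%N).
Qed.

End Cotrajectories.

(** * Entropy of V against entropy of the intersection C *)

Section Main.
Variables (R : realType) (K : fieldType) (V : discTopLmodType K).
Variable phi : {linear V -> V}.
Hypotheses (lcV : linearly_compact [set: V]) (phi_cont : continuous phi).
Implicit Types (f g : nat -> cform V).
Local Notation ent := (topological_entropy phi R).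

Lemma entropy_setT_le r f :
  (forall g : cform V, torsion phi [set: V] r f g) -> (ent [set: V] <= r%:R%:E)%E.
Proof.
move=> tor; apply: entropy_le (setT_invariant phi) _ => // k g gV.
by apply: (indep_torsion_le phi_cont) gV => //; exact: subspaceT.
Qed.

Lemma indep_of_entropy k : (k%:R%:E <= ent [set: V])%E ->
  exists f, indep phi [set: V] k f.
Proof.
case: k => [_|k lek]; first by exists (fun=> cform0 V).
apply: contrapT => nof.
have : (ent [set: V] <= k%:R%:E)%E.
  apply: entropy_le (setT_invariant phi) _ => // r f fV.
  rewrite leqNgt; apply/negP => ltkr; apply: nof; exists f.
  exact: indep_prefix fV.
by move/(le_trans lek); rewrite lee_fin ler_nat ltnn.
Qed.

(** A form not torsion modulo the f_i would extend them to k + 1 independent forms and raise the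
    entropy. The f_i and their multiples vanish on C, so every form is torsion there. *)
Lemma entropy_cotraj_eq0 k f : indep phi [set: V] k f -> ent [set: V] = k%:R%:E ->
  ent (\bigcap_(i in [set i | (i < k)%N]) cotraj phi (f i)) = 0%:E.
Proof.
move=> fV entk; have inv := bigcap_cotraj_invariant phi_cont [set i | (i < k)%N] f.
apply/eqP; rewrite eq_le -[0]/(0%:R); apply/andP; split; last first.
  by apply: (entropy_ge R lcV phi_cont inv (f := f)) => p _ i.
apply: entropy_le inv _ => // -[//|r] g gC.
suff [p p0 [q hq]] : torsion phi setT k f (g 0%N).
  have g1 := indep_prefix (ltn0Sn r) gC.
  case/eqP: p0; apply: (g1 (fun=> p) _ 0%N) => // x Cx.
  rewrite big_ord1 hq // big1 // => i _; apply: cotraj_pact; exact: (Cx i (ltn_ord i)).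
apply: contrapT => ntor.
pose f' i := if (i < k)%N then f i else g 0%N.
have : indep phi setT k.+1 f'.
  apply: indep_ext; first by apply: eq_indep fV => i ik; rewrite /f' ik.
  rewrite {2}/f' ltnn => -[p p0 [q hq]]; apply: ntor; exists p => //; exists q => x Vx.
  by rewrite hq //; apply: eq_bigr => i _; rewrite /f' ltn_ord.
move/(entropy_ge R lcV phi_cont (setT_invariant phi)).
by rewrite entk lee_fin ler_nat ltnn.
Qed.

(** Entropy 0 on C provides for each form g some p <> 0 such that p g vanishes on C; by
    [form_in_orbit_span], p g is a combination of the f_i. Thus g is torsion modulo the f_i and the
    rank is at most k. *)
Lemma entropy_of_cotraj k f : indep phi [set: V] k f ->
  ent (\bigcap_(i in [set i | (i < k)%N]) cotraj phi (f i)) = 0%:E ->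
  ent [set: V] = k%:R%:E.
Proof.
move=> fV ent0; have inv := bigcap_cotraj_invariant phi_cont [set i | (i < k)%N] f.
apply/eqP; rewrite eq_le; apply/andP; split; last exact: entropy_ge (setT_invariant phi) fV.
apply: (entropy_setT_le (f := f)) => g.
set C := \bigcap_(i in _) _ in ent0 inv.
have [p p0 gp] : exists2 p : {poly K}, p != 0 & forall x, C x -> g (pact phi p x) = 0.
  apply: contrapT => nop.
  have : indep phi C 1 (fun=> g).
    move=> p hp i; rewrite ltnS leqn0 => /eqP ->.
    apply/eqP/negPn/negP => p0; apply: nop; exists (p 0%N) => // x Cx.
    by have := hp x Cx; rewrite big_ord1.
  by move/(entropy_ge R lcV phi_cont inv); rewrite ent0 lee_fin -[0]/(0%:R) ler_nat ltn0.
have [|q hq] := @form_in_orbit_span _ _ _ lcV phi_cont k f (cform_pact phi_cont g p).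
  by move=> x fx; apply: gp => i; exact: fx.
by exists p => //; exists q => x _; exact: hq.
Qed.

(** Infinite entropy leaves, after any finite list, a form that is not torsion modulo it; these are
    collected greedily. *)
Lemma infinite_indep : ent [set: V] = +oo%E ->
  exists f, forall n, indep phi [set: V] n f.
Proof.
move=> entoo.
pose new (s : seq (cform V)) (g : cform V) :=
  ~ torsion phi setT (size s) (nth (cform0 V) s) g.
have exnew s : exists g : cform V, new s g.
  apply: contrapT => nog.
  have : (ent [set: V] <= (size s)%:R%:E)%E.
    apply: (entropy_setT_le (f := nth (cform0 V) s)) => g.
    by apply: contrapT => ng; apply: nog; exists g.
  by rewrite entoo leye_eq.
have [G GP] := choice exnew.
have [f fE] := course_of_values G.
exists f; elim=> [p _ //|n fn]; apply: indep_ext => // -[p p0 [q hq]].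
have := GP (mkseq f n); rewrite -fE /new size_mkseq; apply.
exists p => //; exists q => x Vx; rewrite hq //.
by apply: eq_bigr => i _; rewrite nth_mkseq.
Qed.

End Main.

Lemma coindependent_split (K : fieldType) (V : discTopLmodType K) (I : Type)
    (J : set I) (N : I -> set V) i v :
  coindependent_fin J N -> J i ->
  exists2 x, N i x & forall j, J j -> j <> i -> N j (v - x).
Proof.
move=> coN Ji; have [_ sumT] := coN i Ji.
have [x Nx [y Ny <-]] : sum_sub (N i) (\bigcap_(j in J `\ i) N j) v by rewrite sumT.
by exists x => // j Jj ji; rewrite addrC addKr; apply: Ny.
Qed.

Theorem theoremA (R : realType) (K : fieldType) (V : discTopLmodType K)
    (phi : {linear V -> V})
    (lcV : linearly_compact [set: V]) (phi_cont : continuous phi) :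
  (forall k : nat,
     topological_entropy phi R [set: V] = k%:R%:E <->
     exists U : 'I_k -> set V,
       [/\ forall i, nonstationary_cocyclic phi (U i),
           coindependent_fin [set: 'I_k] (fun i => cotrajectory phi (U i)) &
           topological_entropy phi R
             (\bigcap_(i in [set: 'I_k]) cotrajectory phi (U i)) = 0%:E]) /\
  (topological_entropy phi R [set: V] = +oo%E <->
   exists U : nat -> set V,
     (forall i, nonstationary_cocyclic phi (U i)) /\
     coindependent (fun i => cotrajectory phi (U i))).
Proof.
have indep1 n f i : indep phi setT n f -> (i < n)%N ->
    indep phi setT 1 (fun=> f i : cform V).
  move=> fV ltin p hp j; rewrite ltnS leqn0 => /eqP ->.
  have := fV (fun a => if a == i then p 0%N else 0) _ i ltin; rewrite eqxx; apply.
  move=> x Vx; apply: eq_trans (hp x Vx); rewrite big_ord1.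
  rewrite (bigD1 (Ordinal ltin)) //= eqxx big1 ?addr0 // => a.
  by rewrite -val_eqE /= => /negbTE ->; rewrite /pact !linear0.
have capE k (f : nat -> cform V) : \bigcap_(i in [set: 'I_k]) cotraj phi (f i) =
    \bigcap_(i in [set i | (i < k)%N]) cotraj phi (f i).
  apply/seteqP; split=> x fx i ltik; first exact: (fx (Ordinal ltik)).
  exact: (fx i (ltn_ord i)).
split=> [k|]; split.
- move=> entk; have [f fV] : exists f, indep phi setT k f.
    by apply: (indep_of_entropy (R := R)) => //; rewrite entk lexx.
  have cotE : (fun i : 'I_k => cotrajectory phi [set x | f i x = 0]) =
      (fun i : 'I_k => cotraj phi (f i)).
    by apply/funext => i; rewrite cotrajectoryE.
  exists (fun i : 'I_k => [set x | f i x = 0]); split.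
  + move=> i; apply/(nonstationary_cocyclicP lcV phi_cont); exists (f i) => //.
    exact: indep1 fV (ltn_ord i).
  + rewrite cotE; apply: (@cotraj_coindependent _ _ _ lcV phi_cont
      k f 'I_k setT (@nat_of_ord k) (@ord_inj k) _ fV).
    by move=> i _; exact: ltn_ord.
  + by rewrite cotE capE; exact: entropy_cotraj_eq0.
- case=> U [Uns coU ent0].
  have fex i : exists f : cform V, U i = [set x | f x = 0] /\ indep phi setT 1 (fun=> f).
    by have /(nonstationary_cocyclicP lcV phi_cont)[f ? ?] := Uns i; exists f.
  have [F FP] := choice fex.
  pose f i := if insub i is Some i' then F i' else cform0 V.
  have fE (i : 'I_k) : f i = F i by rewrite /f valK.
  have cotE : (fun i : 'I_k => cotrajectory phi (U i)) =
      (fun i : 'I_k => cotraj phi (f i)).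
    by apply/funext => i; rewrite (proj1 (FP i)) cotrajectoryE fE.
  rewrite cotE in coU ent0; rewrite capE in ent0.
  apply: entropy_of_cotraj ent0 => //; apply: split_indep => [i ik|i v ik].
    by rewrite (fE (Ordinal ik)); case: (FP (Ordinal ik)).
  have [x fx fy] := coindependent_split (i := Ordinal ik) v coU I.
  exists x => // j jk ji; apply: (fy (Ordinal jk)) => // /(congr1 val) /= jE.
  by rewrite jE eqxx in ji.
- move=> /(infinite_indep lcV phi_cont)[f fV].
  exists (fun i => [set x | f i x = 0]); split=> [i|J finJ].
    apply/(nonstationary_cocyclicP lcV phi_cont); exists (f i) => //.
    exact: indep1 (fV i.+1) _.
  have -> : (fun i => cotrajectory phi [set x | f i x = 0]) =
      (fun i => cotraj phi (f (id i))).
    by apply/funext => i; rewrite cotrajectoryE.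
  case/finite_fsetP: finJ => X JX.
  (* A finite [J] lies below one more than its maximum, so independence of that many forms is
     enough. *)
  apply: (cotraj_coindependent lcV phi_cont (n := (\max_(i <- X) i).+1)) => // i.
  by rewrite JX /= ltnS => iX; exact: (@leq_bigmax_seq _ _ xpredT id _ iX isT).
- case=> U [Uns coU].
  have fex i : exists f : cform V, U i = [set x | f x = 0] /\ indep phi setT 1 (fun=> f).
    by have /(nonstationary_cocyclicP lcV phi_cont)[f ? ?] := Uns i; exists f.
  have [f fP] := choice fex.
  have cotE : (fun i => cotrajectory phi (U i)) = (fun i => cotraj phi (f i)).
    by apply/funext => i; rewrite (proj1 (fP i)) cotrajectoryE.
  (* The entropy is infinite once it is at least every real r > 0; the first truncn r + 1 forms give
     this bound. *)
  rewrite cotE in coU; apply/eqyP => r r0.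
  apply: le_trans (entropy_ge R lcV phi_cont (setT_invariant phi)
    (k := (Num.truncn r).+1) (f := f) _).
    by rewrite lee_fin ltW // truncnS_gt.
  apply: split_indep => [i _|i v ik]; first by case: (fP i).
  have [x fx fy] := coindependent_split (i := i) v
    (coU `I_(Num.truncn r).+1 (finite_II _)) ik.
  by exists x => // j jk ji; apply: fy => //; apply/eqP.
Qed.
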